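(* Let $m,k$ be positive integers, $v=m(k+1)$, let $A_1$ be the adjacency matrix of the graph $mK_{k+1}$ (the disjoint union of $m$ complete graphs on $k+1$ vertices) and $A_2$ the adjacency matrix of its complement, and let $W:=I+xA_1+yA_2$ with $x,y\in\mathbb{C}$. Then $W$ is a type-II matrix if and only if one of the following holds: (a) $W$ is equivalent to a Potts model; (b) $x=\dfrac{(kv-2k-1)y^2-(v-2k-2)y-1}{k(1-y^2)}$ and $y+y^{-1}=\dfrac{2(k+1)^2-v(k^2+1)}{(k+1)^2-kv}$.
   Context: For a matrix $W$ with all entries non-zero, $W^{(-)}$ denotes its entrywise inverse; a $v\times v$ such matrix is type-II if $W(W^{(-)})^T=vI$. A Potts model of order $v$ is a matrix $(t-1)I+J$ ($J$ the all-ones $v\times v$ matrix) where $t$ is a root of $t^2+(v-2)t+1$. A monomial matrix is a product of a permutation matrix and a diagonal matrix; $W'$ is equivalent to $W$ if $W'=MWN$ for some invertible monomial matrices $M,N$.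
   Formalization: In (b), y≠0 and y²≠1 are explicit, and the second equation is stated as ((k+1)²−kv)(y+y⁻¹)=2(k+1)²−v(k²+1), because for m=2, k=1 the printed fraction is 0/0 (there x=−1 with any y≠0 gives a type-II matrix); otherwise it is equivalent. *)

(* Defs.v *)
From mathcomp Require Import all_boot all_fingroup all_algebra.

Set Implicit Arguments.
Unset Strict Implicit.
Unset Printing Implicit Defensive.

Import GRing.Theory.
Local Open Scope ring_scope.

Section TypeII.
Variables (F : fieldType) (n : nat).
Implicit Types W M N P : 'M[F]_n.

Definition entry_inv W : 'M[F]_n := map_mx (@GRing.inv F) W.

(* The first conjunct is needed because 0^-1 = 0 in a fieldType. *)
Definition type_II W : Prop :=
  (forall i j, W i j != 0) /\ W *m (entry_inv W)^T = n%:R%:M.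

Definition Potts_model P : Prop :=
  exists t : F, t ^+ 2 + (n%:R - 2) * t + 1 = 0 /\
                P = (t - 1) *: 1%:M + const_mx 1.

Definition monomial_mx M : Prop :=
  exists (s : 'S_n) (d : 'rV[F]_n), M = perm_mx s *m diag_mx d.

Definition mx_equivalent W' W : Prop :=
  exists M N, [/\ monomial_mx M, M \in unitmx,
                  monomial_mx N, N \in unitmx & W' = M *m W *m N].

Definition adjacency_mx (e : rel 'I_n) : 'M[F]_n :=
  \matrix_(i, j) (e i j)%:R.

End TypeII.

Definition graph_compl (T : eqType) (e : rel T) : rel T :=
  fun i j => (i != j) && ~~ e i j.

(* The graph m K_(k+1): vertex i lies in the (i %/ k.+1)-th of the m cliques,
   each of which consists of k.+1 consecutive vertices. *)
Definition mK (m k : nat) : rel 'I_(m * k.+1) :=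
  fun i j => (i != j) && (i %/ k.+1 == j %/ k.+1)%N.

(* Main.v *)
(* Since W takes the values 1, x, y, the type-II condition is that the rows
   indexed by two vertices of one clique, resp. of two cliques, are "inversely
   orthogonal".  This gives two equations,
     x^2 + (v - 2) x + 1 = 0                                              (E1)
     x y^2 + x + k (x^2 + y^2) + (v - 2k - 2) x y = 0                     (E2)
   the second one only if m > 1.  Modulo (E1), (E2) is linear in x:
   k (1 - y^2) x = N(y).  If y^2 <> 1, substituting into (E1) gives a quartic
   in y that factors as the Potts polynomial of y times the quadratic of case
   (b), and a root of the Potts polynomial forces x = y.  If y = 1 then k = 1,
   and exchanging the two vertices of each K_2 turns W into a Potts model; if
   y = -1 then v = 4 and x = y. *)
Require Import Defs.
From mathcomp Require Import all_boot all_order all_fingroup all_algebra.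
From mathcomp Require Import all_reals complex.
From mathcomp Require Import zify ring.

Import GRing.Theory Num.Theory.
Local Open Scope ring_scope.
Local Open Scope complex_scope.

(** * Type-II matrices and monomial equivalence *)

Section TypeIIFacts.
Variables (F : fieldType) (n : nat).
Implicit Types W P : 'M[F]_n.

(** Each diagonal entry of the product is a sum of [n] ones, so only pairs of distinct rows impose a
    condition. *)
Lemma type_IIP W :
  type_II W <->
  (forall i j, W i j != 0) /\
  (forall i j, i != j -> \sum_l W i l / W j l = 0).
Proof.
have mulE i j : (W *m (entry_inv W)^T) i j = \sum_l W i l / W j l.
  by rewrite mxE; apply: eq_bigr => l _; rewrite !mxE.
split=> -[W0 HW]; split=> //.
  by move=> i j nij; rewrite -mulE HW !mxE (negPf nij).
apply/matrixP => i j; rewrite mulE !mxE.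
have [<-|nij] := eqVneq i j; last by rewrite HW.
under eq_bigr => l _ do rewrite divff //.
by rewrite sumr_const card_ord.
Qed.

Lemma monomial_mxE (s : 'S_n) (d : 'rV[F]_n) (A : 'M[F]_n) :
  perm_mx s *m diag_mx d *m A = \matrix_(i, j) (d 0 (s i) * A (s i) j).
Proof.
by rewrite -mulmxA -row_permE mul_diag_mx; apply/matrixP => i j; rewrite !mxE.
Qed.

Lemma mulmx_monomialE (s : 'S_n) (d : 'rV[F]_n) (A : 'M[F]_n) :
  A *m (perm_mx s *m diag_mx d) = \matrix_(i, j) (A i (s^-1%g j) * d 0 j).
Proof.
rewrite mulmxA -{1}(invgK s) -col_permE mul_mx_diag.
by apply/matrixP => i j; rewrite !mxE.
Qed.

Lemma unitmx_monomial (s : 'S_n) (d : 'rV[F]_n) :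
  (perm_mx s *m diag_mx d \in unitmx) = [forall i, d 0 i != 0].
Proof.
rewrite unitmx_mul unitmx_perm unitmxE det_diag unitfE /=.
apply/idP/forallP => [/prodf_neq0 H i|H]; first exact: H.
by apply/prodf_neq0 => i _; apply: H.
Qed.

(** Column scalings cancel in each ratio, column permutations reindex the sum, and row scalings come
    out as a common factor. *)
Lemma type_II_equivalent W P : mx_equivalent W P -> type_II P -> type_II W.
Proof.
case=> M [N [[s [d ->]] uM [s' [d' ->]] uN ->]] /type_IIP [P0 HP].
move: uM uN; rewrite !unitmx_monomial => /forallP d0 /forallP d0'.
rewrite monomial_mxE mulmx_monomialE.
apply/type_IIP; split=> [i j|i j nij]; first by rewrite !mxE !mulf_neq0.
have nsij : s i != s j by rewrite (inj_eq perm_inj).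
transitivity (d 0 (s i) / d 0 (s j) *
    \sum_l P (s i) (s'^-1%g l) / P (s j) (s'^-1%g l)).
  rewrite mulr_sumr; apply: eq_bigr => l _; rewrite !mxE; field.
  by rewrite d0 d0' P0.
rewrite [X in _ * X](_ : _ = 0) ?mulr0 // -[RHS](HP _ _ nsij).
by rewrite [RHS](reindex_inj (@perm_inj _ (s'^-1%g))).
Qed.

Lemma mx_equivalent_row_perm (c : F) (s : 'S_n) P :
  c != 0 -> mx_equivalent (c *: row_perm s P) P.
Proof.
move=> c0.
exists (perm_mx s *m diag_mx (const_mx c)), (perm_mx 1 *m diag_mx (const_mx 1)).
split.
- by exists s, (const_mx c).
- by rewrite unitmx_monomial; apply/forallP => i; rewrite mxE.
- by exists 1%g, (const_mx 1).
- by rewrite unitmx_monomial; apply/forallP => i; rewrite mxE oner_eq0.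
rewrite monomial_mxE mulmx_monomialE.
by apply/matrixP => i j; rewrite !mxE invg1 perm1 mulr1.
Qed.

Lemma sum_delta (i : 'I_n) (c : F) : \sum_l (l == i)%:R * c = c.
Proof.
rewrite (bigD1 i) //= eqxx mul1r big1 ?addr0 // => l /negPf ->.
by rewrite mul0r.
Qed.

Lemma potts_mxE (t : F) :
  (t - 1) *: 1%:M + const_mx 1 = \matrix_(i, j < n) (if i == j then t else 1).
Proof.
apply/matrixP => i j; rewrite !mxE; case: (i == j) => /=; first by ring.
by rewrite mulr0 add0r.
Qed.

Lemma potts_root_neq0 (b t : F) : t ^+ 2 + b * t + 1 = 0 -> t != 0.
Proof.
move=> tE; apply/eqP => t0; move/eqP: tE.
by rewrite t0 expr0n mulr0 !add0r oner_eq0.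
Qed.

Lemma type_II_Potts P : Potts_model P -> type_II P.
Proof.
case=> t [tE ->]; rewrite potts_mxE.
have t0 := potts_root_neq0 _ _ tE.
apply/type_IIP; split=> [i j|i j nij].
  by rewrite mxE; case: (i == j); rewrite ?oner_eq0.
(* The ratio is 1 except for [t] at [i] and [t^-1] at [j], so [t] times the sum is the Potts
   quadratic. *)
rewrite (eq_bigr (fun l => 1 + (l == i)%:R * (t - 1)
                               + (l == j)%:R * (t^-1 - 1))); last first.
  move=> l _; rewrite !mxE [i == l]eq_sym [j == l]eq_sym.
  have [li|_] := eqVneq l i; have [lj|_] := eqVneq l j => /=.
  - by move: nij; rewrite -li -lj eqxx.
  - by rewrite divr1; ring.
  - by rewrite div1r; ring.
  - by rewrite divr1; ring.
rewrite !big_split /= !sum_delta sumr_const card_ord.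
apply: (mulfI t0); rewrite mulr0 -[RHS]tE.
by field.
Qed.

End TypeIIFacts.

(** * The equations *)

Section Equations.
Variables (F : fieldType) (k v x y : F).

(** [cliqueD] and [cliqueN] are the denominator and the numerator of x in case (b). *)
Definition cliqueD : F := k * (1 - y ^+ 2).
Definition cliqueN : F :=
  (k * v - 2 * k - 1) * y ^+ 2 - (v - 2 * k - 2) * y - 1.
Definition potts_poly (t : F) : F := t ^+ 2 + (v - 2) * t + 1.
Definition cross_poly : F :=
  x * y ^+ 2 + x + k * (x ^+ 2 + y ^+ 2) + (v - 2 * k - 2) * (x * y).
(** The second equation of case (b), cleared of its denominator and of [y^-1]. *)
Definition caseb_poly : F :=
  ((k + 1) ^+ 2 - k * v) * (y ^+ 2 + 1)
  - (2 * (k + 1) ^+ 2 - v * (k ^+ 2 + 1)) * y.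

Lemma cross_polyP : potts_poly x = 0 ->
  cross_poly = 0 <-> cliqueD * x = cliqueN.
Proof.
move=> E1; have x0 := potts_root_neq0 _ _ _ E1.
(* As [k - cliqueD] is k y^2, this multiple of (E1) absorbs the term of (E2) free of x; what remains
   is x times a linear form in x. *)
have E : cross_poly
    = (k - cliqueD) * potts_poly x + x * (cliqueD * x - cliqueN).
  by rewrite /cross_poly /potts_poly /cliqueD /cliqueN; ring.
rewrite E E1 mulr0 add0r.
split=> [/eqP|->]; last by rewrite subrr mulr0.
by rewrite mulf_eq0 (negPf x0) /= subr_eq0 => /eqP.
Qed.

(** The left side is the Potts polynomial at [cliqueN / cliqueD], cleared of denominators. *)
Lemma quartic_factor :
  cliqueN ^+ 2 + (v - 2) * cliqueN * cliqueD + cliqueD ^+ 2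
  = potts_poly y * caseb_poly.
Proof. by rewrite /cliqueN /cliqueD /potts_poly /caseb_poly; ring. Qed.

Lemma quartic_pottsE : cliqueD * x = cliqueN ->
  cliqueD ^+ 2 * potts_poly x = potts_poly y * caseb_poly.
Proof.
by move=> E; rewrite -quartic_factor -E /potts_poly; ring.
Qed.

Lemma potts_poly_eq : cliqueD != 0 -> cliqueD * x = cliqueN ->
  potts_poly y = 0 -> x = y.
Proof.
move=> D0 E Ey; apply: (mulfI D0); rewrite E; apply/eqP; rewrite -subr_eq0.
(* A Potts root y thus solves the same linear equation as x. *)
have -> : cliqueN - cliqueD * y = (k * y - 1) * potts_poly y.
  by rewrite /cliqueN /cliqueD /potts_poly; ring.
by rewrite Ey mulr0.
Qed.

Lemma caseb_polyP : y != 0 ->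
  ((k + 1) ^+ 2 - k * v) * (y + y^-1)
    = 2 * (k + 1) ^+ 2 - v * (k ^+ 2 + 1) <-> caseb_poly = 0.
Proof.
move=> y0.
have -> : caseb_poly = y * (((k + 1) ^+ 2 - k * v) * (y + y^-1)
    - (2 * (k + 1) ^+ 2 - v * (k ^+ 2 + 1))).
  by rewrite /caseb_poly; field.
split=> [->|/eqP]; first by rewrite subrr mulr0.
by rewrite mulf_eq0 (negPf y0) /= subr_eq0 => /eqP.
Qed.

End Equations.

Arguments cliqueD {F}.
Arguments cliqueN {F}.
Arguments potts_poly {F}.
Arguments cross_poly {F}.
Arguments caseb_poly {F}.

(** * Matrices in the span of I, A1, A2 *)

Section Cliques.
Variables (F : numFieldType) (m k : nat) (x y : F).
Hypotheses (m0 : (0 < m)%N) (k0 : (0 < k)%N).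

Let v := (m * k.+1)%N.
Let q (i : 'I_v) := (i %/ k.+1)%N.

Definition clique_mx : 'M[F]_v :=
  1%:M + x *: adjacency_mx F (@mK m k)
       + y *: adjacency_mx F (graph_compl (@mK m k)).

Lemma clique_mxE i j :
  clique_mx i j = if i == j then 1 else if q i == q j then x else y.
Proof.
rewrite !mxE /graph_compl /mK -/(q i) -/(q j).
case: (i == j) => /=; first by ring.
by case: (q i == q j) => /=; ring.
Qed.

Lemma sum_clique i (c : F) : \sum_l (q l == q i)%:R * c = k.+1%:R * c.
Proof.
rewrite -mulr_suml -natr_sum; congr (_%:R * _).
(* Induction on the number [p] of cliques: the block of [k.+1] vertices added last has quotient
   [p]. *)
have H (r p : nat) :
    (\sum_(0 <= l < p * k.+1) (l %/ k.+1 == r) = (r < p) * k.+1)%N.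
  elim: p => [|p IHp]; first by rewrite big_nil.
  rewrite mulSnr (big_cat_nat (n := (p * k.+1)%N)) ?leq_addr //= IHp.
  rewrite -{1}[(p * k.+1)%N]add0n big_addn addKn.
  rewrite (eq_big_nat _ _ (F2 := fun=> nat_of_bool (p == r))).
    rewrite sum_nat_const_nat; case: (ltngtP r p) => h; lia.
  by move=> l /andP[_ lk]; rewrite divnDMl // divn_small.
rewrite -[LHS](big_mkord xpredT (fun l => nat_of_bool (l %/ k.+1 == q i)%N)) H.
by rewrite ltn_divLR ?ltn_ord ?mul1n.
Qed.

(** The rows differ only in columns [i] and [j], so the ratios sum to v - 2 + x + x^-1. The
    condition on [y] is guarded because [y] is not an entry when m = 1. *)
Lemma clique_mx_row_same i j : i != j -> q i = q j -> x != 0 ->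
  (forall i j, q i != q j -> y != 0) ->
  x * (\sum_l clique_mx i l / clique_mx j l) = potts_poly v%:R x.
Proof.
move=> nij qij x0 y0.
rewrite (eq_bigr (fun l => 1 + (l == i)%:R * (x^-1 - 1)
                               + (l == j)%:R * (x - 1))); last first.
  move=> l _; rewrite !clique_mxE [i == l]eq_sym [j == l]eq_sym.
  have [li|_] := eqVneq l i; have [lj|_] := eqVneq l j => /=.
  - by move: nij; rewrite -li -lj eqxx.
  - by rewrite li qij eqxx; field.
  - by rewrite lj qij eqxx; field.
  rewrite qij !mul0r !addr0.
  by case: (eqVneq (q j) (q l)) => [_|/y0 ny]; rewrite divff.
rewrite !big_split /= !sum_delta sumr_const card_ord /potts_poly.
by field.
Qed.

Lemma clique_mx_row_diff i j : q i != q j -> x != 0 -> y != 0 ->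
  x * y * (\sum_l clique_mx i l / clique_mx j l) = cross_poly k%:R v%:R x y.
Proof.
move=> nq x0 y0.
(* The ratio is x/y on the clique of [i], y/x on that of [j] and 1 elsewhere; the last two terms
   correct for the diagonal entries. *)
rewrite (eq_bigr (fun l => 1 + (q l == q i)%:R * (x / y - 1)
     + (q l == q j)%:R * (y / x - 1)
     + (l == i)%:R * (y^-1 - x / y) + (l == j)%:R * (y - y / x))); last first.
  move=> l _; rewrite !clique_mxE [i == l]eq_sym [j == l]eq_sym.
  rewrite [q i == _]eq_sym [q j == _]eq_sym.
  have [li|_] := eqVneq l i; have [lj|_] := eqVneq l j => /=.
  - by move: nq; rewrite -li -lj eqxx.
  - by rewrite li eqxx (negPf nq) /=; field; rewrite x0 y0.
  - by rewrite lj eqxx [q j == q i]eq_sym (negPf nq) /=; field; rewrite x0 y0.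
  have [li|_] := eqVneq (q l) (q i); have [lj|_] := eqVneq (q l) (q j) => /=.
  - by move: nq; rewrite -li -lj eqxx.
  - by field; rewrite x0 y0.
  - by field; rewrite x0 y0.
  - by field; rewrite x0 y0.
rewrite !big_split /= !sum_delta !sum_clique sumr_const card_ord /cross_poly.
by rewrite -natr1; field; rewrite x0 y0.
Qed.

Lemma type_II_cliqueP :
  type_II clique_mx <->
  potts_poly v%:R x = 0 /\
  ((1 < m)%N -> y != 0 /\ cross_poly k%:R v%:R x y = 0).
Proof.
(* Test vertices: 0 and 1 share a clique since k > 0; for m > 1, vertex k + 1 opens the second
   clique. *)
have v0 : (0 < v)%N by rewrite /v; nia.
have v1 : (1 < v)%N by rewrite /v; nia.
have nq01 : Ordinal v0 != Ordinal v1 by [].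
have q01 : q (Ordinal v0) = q (Ordinal v1) by rewrite /q /= div0n divn_small.
split.
  case/type_IIP => W0 WW.
  have x0 : x != 0.
    by have := W0 (Ordinal v0) (Ordinal v1); rewrite clique_mxE /= q01 eqxx.
  have y0 i j : q i != q j -> y != 0.
    move=> nq; have := W0 i j; rewrite clique_mxE (negPf nq) ifN //.
    by apply: contraNN nq => /eqP ->.
  split=> [|m1].
    by rewrite -(clique_mx_row_same _ _ nq01 q01 x0 y0) WW ?mulr0.
  have vk : (k.+1 < v)%N by rewrite /v; nia.
  have nq : q (Ordinal v0) != q (Ordinal vk) by rewrite /q /= div0n divnn.
  have y1 := y0 _ _ nq; split=> //.
  by rewrite -(clique_mx_row_diff _ _ nq x0 y1) WW ?mulr0.
case=> E1 E2.
have x0 := potts_root_neq0 _ _ _ E1.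
have m1 (i j : 'I_v) : q i != q j -> (1 < m)%N.
  rewrite ltnNge; apply: contraNN => m1.
  have mE : m = 1%N by lia.
  have q0 (l : 'I_v) : q l = 0%N.
    by apply: divn_small; case: l => l /=; rewrite /v mE mul1n.
  by rewrite !q0.
have y0 i j : q i != q j -> y != 0 by move=> /m1 /E2 [].
apply/type_IIP; split=> [i j|i j nij].
  rewrite clique_mxE; case: (i == j); first by rewrite oner_eq0.
  by case: (eqVneq (q i) (q j)) => // /y0.
have [qij|nq] := eqVneq (q i) (q j).
  apply: (mulfI x0); rewrite mulr0.
  by rewrite clique_mx_row_same.
have [y1 E2'] := E2 (m1 _ _ nq).
apply: (mulfI (mulf_neq0 x0 y1)); rewrite mulr0.
by rewrite clique_mx_row_diff.
Qed.

(** All off-diagonal entries are [x], so dividing by [x] leaves the Potts matrix of [x^-1], a root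
    too because the quadratic is palindromic. *)
Lemma clique_mx_const_Potts : potts_poly v%:R x = 0 ->
  (forall i j, q i != q j -> x = y) ->
  exists P : 'M[F]_v, Potts_model P /\ mx_equivalent clique_mx P.
Proof.
move=> E1 xy; have x0 := potts_root_neq0 _ _ _ E1.
exists ((x^-1 - 1) *: 1%:M + const_mx 1); split.
  exists x^-1; split=> //; apply: (mulfI (expf_neq0 2 x0)).
  by rewrite mulr0 -[RHS]E1 /potts_poly; field.
rewrite potts_mxE.
suff -> : clique_mx =
    x *: row_perm 1 (\matrix_(i, j < v) (if i == j then x^-1 else 1)).
  exact: mx_equivalent_row_perm.
apply/matrixP => i j; rewrite clique_mxE !mxE perm1.
case: (i == j); first by rewrite divff.
by rewrite mulr1; case: (eqVneq (q i) (q j)) => // /xy.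
Qed.

End Cliques.

(** * The case of disjoint edges, k = 1 *)

Lemma pair_partner_subproof (m : nat) (i : 'I_(m * 2)) :
  ((if odd i then i.-1 else i.+1) < m * 2)%N.
Proof. by case: i => i /=; case: ifP; lia. Qed.

Definition pair_partner (m : nat) (i : 'I_(m * 2)) : 'I_(m * 2) :=
  Ordinal (pair_partner_subproof m i).

Lemma pair_partnerP (m : nat) (i j : 'I_(m * 2)) :
  (pair_partner m i == j) = (i != j) && (i %/ 2 == j %/ 2)%N.
Proof. by rewrite -!val_eqE /=; case: ifP; lia. Qed.

Lemma pair_partner_inj (m : nat) : injective (pair_partner m).
Proof.
move=> i j /(congr1 val) /= E; apply/val_inj => /=.
by move: E; case: ifP; case: ifP; lia.
Qed.

(** With y = 1 the entry [x] occurs exactly at partners, so swapping partner rows moves it to the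
    diagonal. *)
Lemma clique_mx_pairs_Potts (F : numFieldType) (m : nat) (x : F) :
  potts_poly (m * 2)%:R x = 0 ->
  exists P, Potts_model P /\ mx_equivalent (clique_mx F m 1 x 1) P.
Proof.
move=> E1; exists ((x - 1) *: 1%:M + const_mx 1); split; first by exists x.
rewrite potts_mxE.
suff -> : clique_mx F m 1 x 1 = 1 *: row_perm (perm (pair_partner_inj m))
    (\matrix_(i, j) (if i == j then x else 1)).
  by apply: mx_equivalent_row_perm; rewrite oner_eq0.
apply/matrixP => i j; rewrite clique_mxE !mxE permE pair_partnerP mul1r.
by case: (i == j).
Qed.

(** * The classification *)

Lemma type_II_clique_classification (F : numFieldType) (m k : nat) (x y : F) :
  (0 < m)%N -> (0 < k)%N ->
  let v := (m * k.+1)%N in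
  type_II (clique_mx F m k x y) <->
  (exists P : 'M[F]_v, Potts_model P /\ mx_equivalent (clique_mx F m k x y) P)
  \/
  [/\ y != 0, 1 - y ^+ 2 != 0,
      x = cliqueN k%:R v%:R y / cliqueD k%:R y &
      ((k%:R + 1) ^+ 2 - k%:R * v%:R) * (y + y^-1)
        = 2 * (k%:R + 1) ^+ 2 - v%:R * (k%:R ^+ 2 + 1) :> F].
Proof.
move=> m0 k0 v.
have kF : k%:R != 0 :> F by rewrite pnatr_eq0 -lt0n.
have vF : v%:R != 0 :> F by rewrite pnatr_eq0 -lt0n muln_gt0 m0.
split; last first.
  case=> [[P [/type_II_Potts PII WP]]|[y0 y1 xE /caseb_polyP bE]].
    exact: type_II_equivalent _ _ _ _ WP PII.
  have D0 : cliqueD k%:R y != 0 by rewrite /cliqueD mulf_neq0.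
  have DE : cliqueD k%:R y * x = cliqueN k%:R v%:R y by rewrite xE mulrC divfK.
  have E1 : potts_poly v%:R x = 0.
    apply: (mulfI (expf_neq0 2 D0)).
    by rewrite mulr0 (quartic_pottsE _ _ _ _ _ DE) bE ?mulr0.
  by apply/type_II_cliqueP => //; split=> // _; split=> //; apply/cross_polyP.
case/type_II_cliqueP => // E1 E2.
have [m1|m1] := leqP m 1.
  left; apply: clique_mx_const_Potts => // i j.
  have mE : m = 1%N by lia.
  have lt_k (l : 'I_(m * k.+1)) : (l < k.+1)%N.
    by case: l => l /=; rewrite mE mul1n.
  by rewrite !divn_small ?eqxx.
have [y0 Ecr] := E2 m1.
have [y1|y1] := eqVneq (1 - y ^+ 2) 0; last first.
  have D0 : cliqueD k%:R y != 0 by rewrite /cliqueD mulf_neq0.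
  have DE : cliqueD k%:R y * x = cliqueN k%:R v%:R y by apply/cross_polyP.
  have := quartic_pottsE _ _ _ _ _ DE.
  (* The two factors of the quartic separate the outcomes: a Potts root y gives x = y, the other
     factor gives case (b). *)
  rewrite E1 mulr0 => /esym/eqP; rewrite mulf_eq0 => /orP[/eqP Ey|/eqP Eb].
    left; apply: clique_mx_const_Potts => // i j _.
    exact: potts_poly_eq _ _ _ _ _ D0 DE Ey.
  by right; split=> //; [rewrite -DE mulrAC divff ?mul1r | apply/caseb_polyP].
left; have : (y == 1) || (y == -1).
  by rewrite -eqf_sqr expr1n -subr_eq0 -opprB y1 oppr0.
have x0 := potts_root_neq0 _ _ _ E1.
case/orP=> /eqP yE; subst y.
  (* Subtracting k times (E1) from (E2) cancels the terms in x^2 and the constants. *)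
  have /eqP : x * v%:R * (1 - k%:R) = 0.
    transitivity (cross_poly k%:R v%:R x 1 - k%:R * potts_poly v%:R x).
      by rewrite /cross_poly /potts_poly; ring.
    by rewrite Ecr E1 mulr0 subrr.
  rewrite !mulf_eq0 (negPf x0) (negPf vF) /= subr_eq0.
  by rewrite eq_sym pnatr_eq1 => /eqP kE; subst k; apply: clique_mx_pairs_Potts.
(* The same combination at y = -1 forces v = 4, which turns (E1) into a square. *)
have /eqP : x * (k%:R + 1) * (4 - v%:R) = 0.
  transitivity (cross_poly k%:R v%:R x (-1) - k%:R * potts_poly v%:R x).
    by rewrite /cross_poly /potts_poly; ring.
  by rewrite Ecr E1 mulr0 subrr.
rewrite !mulf_eq0 (negPf x0) natr1 pnatr_eq0 /= subr_eq0 eqr_nat => /eqP vE.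
apply: clique_mx_const_Potts => // i j _.
have /eqP : (x + 1) ^+ 2 = 0 by rewrite -[RHS]E1 /potts_poly -/v -vE; ring.
by rewrite expf_eq0 /= addr_eq0 => /eqP.
Qed.

(* In (b), y != 0 and 1 - y ^+ 2 != 0 say that y^-1 and the formula for x are
   defined. The equation for y + y^-1 is cleared of its denominator, which
   vanishes only for (m, k) = (2, 1), where the numerator vanishes as well. *)
Theorem theorem8p2 (R : realType) (m k : nat) (hm : (0 < m)%N) (hk : (0 < k)%N)
    (x y : R[i]) :
  let v := (m * k.+1)%N in
  let A1 : 'M[R[i]]_v := adjacency_mx R[i] (@mK m k) in
  let A2 : 'M[R[i]]_v := adjacency_mx R[i] (graph_compl (@mK m k)) in
  let W : 'M[R[i]]_v := 1%:M + x *: A1 + y *: A2 in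
  type_II W <->
  (exists P : 'M[R[i]]_v, Potts_model P /\ mx_equivalent W P)
  \/
  [/\ y != 0, 1 - y ^+ 2 != 0,
      x = ((k%:R * v%:R - 2 * k%:R - 1) * y ^+ 2
             - (v%:R - 2 * k%:R - 2) * y - 1)
          / (k%:R * (1 - y ^+ 2)) &
      ((k%:R + 1) ^+ 2 - k%:R * v%:R) * (y + y^-1)
        = 2 * (k%:R + 1) ^+ 2 - v%:R * (k%:R ^+ 2 + 1)].
Proof. exact: type_II_clique_classification. Qed.
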